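(* Consider any tabular and episodic MDP satisfying the Reset Cliff assumption. With any fixed unbiased estimation $\widehat P^{\pi^{E}}_h(s,a)$ of $P^{\pi^{E}}_h(s,a)$ established from the expert dataset $\mathcal D$, suppose that $\pi^{\mathrm{AIL}}$ is any minimizer over $\pi\in\Pi$ of $$\sum_{h=1}^H\sum_{(s,a)\in\mathcal S\times\mathcal A}\bigl|P^\pi_h(s,a)-\widehat P^{\pi^{E}}_h(s,a)\bigr|.$$ When $|\mathcal D|\ge1$, the following optimality condition holds almost surely: $$\pi^{\mathrm{AIL}}_h(a^1|s)=1\qquad\text{for all }s\in\mathcal S^{G}\text{ and all }h\in[H-1].$$
   Context: A tabular episodic MDP is a tuple $(\mathcal S,\mathcal A,P,r,H,\rho)$ with finite $\mathcal S,\mathcal A$, horizon $H$, time-dependent transitions $P_h(s'|s,a)$, rewards $r_h:\mathcal S\times\mathcal A\to[0,1]$, and initial state distribution $\rho$. $\Pi$ is the set of all non-stationary stochastic policies $\pi=(\pi_1,\dots,\pi_H)$, $\pi_h:\mathcal S\to\Delta(\mathcal A)$. $P^\pi_h(s,a)$ is the probability that $(s_h,a_h)=(s,a)$ under $\pi$. The expert $\pi^{E}$ is deterministic; $\mathcal D$ consists of i.i.d. length-$H$ trajectories of $\pi^{E}$, and $|\mathcal D|$ is their number. $[n]=\{1,\dots,n\}$. Reset Cliff assumption: $\mathcal S=\mathcal S^{G}\cup\mathcal S^{B}$ with $\mathcal S^{G}\cap\mathcal S^{B}=\emptyset$ (good and bad states). For any good state, $a^1$ is the expert action with reward $1$ and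 the others are non-expert actions with reward $0$; for any bad state all actions have reward $0$. For all $h\in[H]$ and $s,s'\in\mathcal S^{G}$: $P_h(s'|s,a^1)>0$, and $\sum_{s''\in\mathcal S^{G}}P_h(s''|s,a^1)=1$. For all $h\in[H]$, $s\in\mathcal S^{G}$ and $a\neq a^1$: $P_h(s'|s,a)=0$ for every $s'\in\mathcal S^{G}$, so the agent moves to bad states. From bad states, every action leads only to bad states. The expert policy never visits bad states.
   Formalization: The estimate is assumed to be a probability distribution over state-action pairs at each step, and at the first step the conclusion is claimed only for good states with positive initial probability; without either condition the statement is false. *)

(* Defs.v *)
From HB Require Import structures.
From mathcomp Require Import all_boot all_order all_algebra.
From mathcomp Require Import all_classical all_reals all_analysis.

Set Implicit Arguments.
Unset Strict Implicit.
Unset Printing Implicit Defensive.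

Import Order.TTheory GRing.Theory Num.Theory.
Local Open Scope ring_scope.

Definition is_dist (R : realType) (T : finType) (mu : T -> R) : Prop :=
  (forall x, 0 <= mu x) /\ \sum_x mu x = 1.

(* Time steps are 0-based: h : 'I_H stands for step h + 1 of {1, ..., H}. *)
Record mdp (R : realType) (S A : finType) (H : nat) := Mdp {
  init : S -> R;
  trans : 'I_H -> S -> A -> S -> R;
  reward : 'I_H -> S -> A -> R;
  init_dist : is_dist init;
  trans_dist : forall h s a, is_dist (trans h s a);
  reward_bounds : forall h s a, 0 <= reward h s a <= 1
}.

Record policy (R : realType) (S A : finType) (H : nat) := Policy {
  policy_fun :> 'I_H -> S -> A -> R;
  policy_dist : forall h s, is_dist (policy_fun h s)
}.

Definition trajectory (S A : finType) (H : nat) : finType :=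
  {ffun 'I_H -> S * A}.

(* init(s_1) * prod_h pi_h(a_h|s_h) * prod_(h < H) P_h(s_(h+1)|s_h,a_h).
   The filters pick out the first step and the pairs (h, k) with k = h + 1.
   The action rule is a raw function so that deterministic policies fit. *)
Definition traj_prob (R : realType) (S A : finType) (H : nat)
    (M : mdp R S A H) (pi : 'I_H -> S -> A -> R) (tr : trajectory S A H) : R :=
  (\prod_(h < H | h == 0 :> nat) init M (tr h).1)
  * (\prod_(h < H) pi h (tr h).1 (tr h).2)
  * \prod_(h < H) \prod_(k < H | k == h.+1 :> nat)
      trans M h (tr h).1 (tr h).2 (tr k).1.

Definition occupancy (R : realType) (S A : finType) (H : nat)
    (M : mdp R S A H) (pi : 'I_H -> S -> A -> R)
    (h : 'I_H) (s : S) (a : A) : R :=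
  \sum_(tr : trajectory S A H | tr h == (s, a)) traj_prob M pi tr.

Definition deterministic (R : realType) (S A : finType) (H : nat)
    (piE : 'I_H -> S -> A) : 'I_H -> S -> A -> R :=
  fun h s a => (a == piE h s)%:R.

Record reset_cliff (R : realType) (S A : finType) (H : nat)
    (M : mdp R S A H) (piE : 'I_H -> S -> A) (a1 : A) (G B : {set S}) : Prop :=
  ResetCliff {
  rc_cover : G :|: B = [set: S];
  rc_disjoint : G :&: B = finset.set0;
  rc_expert : forall h s, s \in G -> piE h s = a1;
  rc_reward_expert : forall h s, s \in G -> reward M h s a1 = 1;
  rc_reward_other :
    forall h s a, s \in G -> a != a1 -> reward M h s a = 0;
  rc_reward_bad : forall h s a, s \in B -> reward M h s a = 0;
  rc_trans_pos :
    forall h s s', s \in G -> s' \in G -> 0 < trans M h s a1 s';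
  rc_trans_good :
    forall h s, s \in G -> \sum_(s' in G) trans M h s a1 s' = 1;
  rc_trans_cliff :
    forall h s a s', s \in G -> a != a1 -> s' \in G -> trans M h s a s' = 0;
  rc_trans_bad :
    forall h s a s', s \in B -> s' \in G -> trans M h s a s' = 0;
  rc_expert_avoids_bad :
    forall h s a, s \in B -> occupancy M (deterministic R piE) h s a = 0
}.

(* The trajectories in D are i.i.d. with the law of a pi-trajectory.  As the
   set of datasets is finite, this is the product form of the joint law. *)
Definition iid_dataset (R : realType) (S A : finType) (H : nat)
    (d : measure_display) (Omega : measurableType d) (Pr : probability Omega R)
    (M : mdp R S A H) (pi : 'I_H -> S -> A -> R) (n : nat)
    (D : Omega -> n.-tuple (trajectory S A H)) : Prop :=
  forall ds : n.-tuple (trajectory S A H),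
    measurable [set w | D w = ds]%classic /\
    Pr [set w | D w = ds]%classic
      = (\prod_(i < n) traj_prob M pi (tnth ds i))%:E.

Definition estimator (R : realType) (S A : finType) (H n : nat) :=
  n.-tuple (trajectory S A H) -> 'I_H -> S -> A -> R.

(* An estimate of the distribution of (s_h, a_h) is itself a distribution:
   signed or unnormalised estimates are excluded. *)
Definition distribution_valued (R : realType) (S A : finType) (H n : nat)
    (Phat : estimator R S A H n) : Prop :=
  forall ds h, is_dist (fun sa : S * A => Phat ds h sa.1 sa.2).

Definition unbiased (R : realType) (S A : finType) (H : nat)
    (d : measure_display) (Omega : measurableType d) (Pr : probability Omega R)
    (M : mdp R S A H) (pi : 'I_H -> S -> A -> R) (n : nat)
    (D : Omega -> n.-tuple (trajectory S A H))
    (Phat : estimator R S A H n) : Prop :=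
  forall h s a,
    ('E_Pr[fun w => Phat (D w) h s a] = (occupancy M pi h s a)%:E)%E.

Definition ail_loss (R : realType) (S A : finType) (H : nat)
    (M : mdp R S A H) (target : 'I_H -> S -> A -> R)
    (pi : policy R S A H) : R :=
  \sum_(h < H) \sum_(sa : S * A)
    `|occupancy M pi h sa.1 sa.2 - target h sa.1 sa.2|.

Definition ail_minimizer (R : realType) (S A : finType) (H : nat)
    (M : mdp R S A H) (target : 'I_H -> S -> A -> R)
    (pi : policy R S A H) : Prop :=
  forall pi' : policy R S A H,
    ail_loss M target pi <= ail_loss M target pi'.

(* Main.v *)
Require Import Defs.
From HB Require Import structures.
From mathcomp Require Import all_boot all_order all_algebra.
From mathcomp Require Import all_classical all_reals all_analysis.
From mathcomp Require Import measurable_realfun zify lra.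

(* Almost surely the estimate is carried by the pairs (s, a1) with s good: its
   other values are nonnegative with expectation 0.  Since both arguments are
   distributions, the l1 loss at one step is 2 - 2 sum min(P^pi, Phat), so a
   minimizer maximizes the overlap with the estimate.  Always playing a1
   dominates the occupancy of every policy at all pairs (s, a1) with s good,
   hence is a minimizer, and every minimizer pi has the same overlap with the
   estimate at each triple (h, s, a).  If pi puts mass less than 1 on the pairs
   (s, a1) at a step h < H, its good mass at step h + 1 is less than 1 and so
   smaller than the estimate at some good s'; as all transition probabilities
   between good states are positive, always playing a1 has strictly larger
   occupancy there, a contradiction.  So pi has mass 1 on these pairs at every
   step h < H; in particular it reaches every good state with positive
   probability (at the first step: those charged by init), where it must then
   play a1. *)

Import Order.TTheory GRing.Theory Num.Theory.
Local Open Scope ring_scope.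

(** * Marginals of a Markov chain on trajectories *)

(** Weight of the path [x 0, ..., x n] of a time-inhomogeneous chain. Paths are indexed by [nat], so
    that induction on [n] needs no casts between ordinal types. *)
Definition path_weight {R : realType} {T : finType} (mu : T -> R)
    (K : nat -> T -> T -> R) (n : nat) (x : nat -> T) : R :=
  mu (x 0%N) * \prod_(k < n) K k (x k) (x k.+1).

Fixpoint marginal {R : realType} {T : finType} (mu : T -> R)
    (K : nat -> T -> T -> R) (h : nat) (t : T) : R :=
  if h is k.+1 then \sum_u marginal mu K k u * K k u t else mu t.

Definition ffun_rcons {T : finType} {n : nat} (f : {ffun 'I_n.+1 -> T}) (t : T) :
    {ffun 'I_n.+2 -> T} :=
  [ffun i : 'I_n.+2 => if (i <= n)%N then f (inord i) else t].

Lemma ffun_rcons_lt {T : finType} {n : nat} (f : {ffun 'I_n.+1 -> T}) t k :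
  (k <= n)%N -> ffun_rcons f t (inord k) = f (inord k).
Proof. by move=> kn; rewrite ffunE inordK ?kn // ltnS ltnW. Qed.

Lemma ffun_rcons_last {T : finType} {n : nat} (f : {ffun 'I_n.+1 -> T}) t :
  ffun_rcons f t (inord n.+1) = t.
Proof. by rewrite ffunE inordK // ltnn. Qed.

Lemma sum_ffun_rcons {R : realType} {T : finType} {n : nat}
    (F : {ffun 'I_n.+2 -> T} -> R) :
  \sum_f F f = \sum_(f : {ffun 'I_n.+1 -> T}) \sum_t F (ffun_rcons f t).
Proof.
rewrite pair_big /= (reindex (fun p => ffun_rcons p.1 p.2)) //=.
exists (fun g : {ffun 'I_n.+2 -> T} =>
  ([ffun i : 'I_n.+1 => g (inord i)], g (inord n.+1))) => [[f t] _|g _] /=.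
  rewrite ffun_rcons_last; congr (_, _); apply/ffunP => i.
  by rewrite ffunE ffun_rcons_lt ?inord_val // -ltnS.
apply/ffunP => i; rewrite ffunE; case: leqP => ni.
  by rewrite ffunE inordK ?inord_val.
by congr (g _); apply/val_inj; rewrite /= inordK //; have := ltn_ord i; lia.
Qed.

Lemma path_weight_rcons {R : realType} {T : finType} (mu : T -> R) K n
    (f : {ffun 'I_n.+1 -> T}) t :
  path_weight mu K n.+1 (fun k => ffun_rcons f t (inord k)) =
  path_weight mu K n (fun k => f (inord k)) * K n (f (inord n)) t.
Proof.
rewrite /path_weight big_ord_recr /= ffun_rcons_lt // ffun_rcons_last.
rewrite ffun_rcons_lt // mulrA; congr (_ * _ * _); apply: eq_bigr => k _.
by rewrite !ffun_rcons_lt // ltnW.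
Qed.

(** Induction on the path length, splitting off the last state. If [h] is the last time, grouping by
    the state before it gives the recursion of [marginal]; otherwise the last state sums out to
    1. *)
Lemma sum_path_weight {R : realType} {T : finType} (mu : T -> R) K n h t :
  (forall k u, \sum_v K k u v = 1) -> (h <= n)%N ->
  \sum_(f : {ffun 'I_n.+1 -> T} | f (inord h) == t)
     path_weight mu K n (fun k => f (inord k)) = marginal mu K h t.
Proof.
move=> K1; elim: n h t => [|n IHn] h t.
  rewrite leqn0 => /eqP->; rewrite (big_pred1 [ffun=> t]) => [|f].
    by rewrite /path_weight big_ord0 mulr1 ffunE.
  apply/eqP/eqP => [<-|->]; last by rewrite ffunE.
  by apply/ffunP => i; rewrite ffunE; congr (f _); rewrite !ord1.
rewrite big_mkcond sum_ffun_rcons leq_eqVlt ltnS => /predU1P[->|hn] /=.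
  transitivity (\sum_(f : {ffun 'I_n.+1 -> T})
      path_weight mu K n (fun k => f (inord k)) * K n (f (inord n)) t).
    apply: eq_bigr => f _; rewrite -big_mkcond (big_pred1 t) => [|u].
      exact: path_weight_rcons.
    by rewrite ffun_rcons_last.
  rewrite (partition_big (fun f : {ffun 'I_n.+1 -> T} => f (inord n)) predT) //=.
  apply: eq_bigr => u _; rewrite -IHn // mulr_suml.
  by apply: eq_bigr => f /eqP->.
rewrite -IHn // [RHS]big_mkcond; apply: eq_bigr => f _.
transitivity (\sum_u if f (inord h) == t then
    path_weight mu K n (fun k => f (inord k)) * K n (f (inord n)) u else 0).
  by apply: eq_bigr => u _; rewrite ffun_rcons_lt // path_weight_rcons.
by case: ifP => _; [rewrite -mulr_sumr K1 mulr1 | rewrite big1].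
Qed.

(** State-action pairs form a Markov chain: the policy is folded into the initial law and the
    kernel, each step drawing the next state and then its action. *)
Definition initial_law {R : realType} {S A : finType} {n : nat} (M : mdp R S A n.+1)
    (pi : 'I_n.+1 -> S -> A -> R) (x : S * A) : R :=
  init M x.1 * pi ord0 x.1 x.2.

Definition kernel_law {R : realType} {S A : finType} {n : nat} (M : mdp R S A n.+1)
    (pi : 'I_n.+1 -> S -> A -> R) (k : nat) (x y : S * A) : R :=
  trans M (inord k) x.1 x.2 y.1 * pi (inord k.+1) y.1 y.2.

Lemma sum_dist_mul {R : realType} {S A : finType} (mu : S -> R) (q : S -> A -> R) :
  is_dist mu -> (forall s, is_dist (q s)) -> \sum_x mu x.1 * q x.1 x.2 = 1.
Proof.
move=> [_ mu1] q1; rewrite -(pair_big xpredT xpredT (fun s a => mu s * q s a)) /=.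
by rewrite -mu1; apply: eq_bigr => s _; rewrite -mulr_sumr (q1 s).2 mulr1.
Qed.

Lemma traj_probE {R : realType} {S A : finType} {n : nat} (M : mdp R S A n.+1)
    (pi : 'I_n.+1 -> S -> A -> R) (tr : trajectory S A n.+1) :
  traj_prob M pi tr =
  path_weight (initial_law M pi) (kernel_law M pi) n (fun k => tr (inord k)).
Proof.
have inord0 : inord 0 = ord0 :> 'I_n.+1 by apply/val_inj; rewrite /= inordK.
rewrite /traj_prob (big_pred1 ord0) // big_ord_recl big_ord_recr /=.
(* The last step has no successor, so its inner product of transitions is empty. *)
rewrite [X in _ * (_ * X)]big1 ?mulr1; last first.
  by move=> k /eqP kn; have := ltn_ord k; rewrite kn ltnn.
rewrite /path_weight /initial_law inord0 -!mulrA; congr (_ * (_ * _)).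
rewrite -big_split; apply: eq_bigr => k _ /=.
have kE : inord k = widen_ord (leqnSn n) k by apply/val_inj; rewrite /= inordK // ltnS ltnW.
have kSE : inord k.+1 = lift ord0 k by apply/val_inj; rewrite /= inordK // ltnS.
rewrite /kernel_law kE kSE mulrC; congr (_ * _).
by rewrite (big_pred1 (lift ord0 k)).
Qed.

Lemma occupancy_marginal {R : realType} {S A : finType} {n : nat} (M : mdp R S A n.+1)
    (pi : 'I_n.+1 -> S -> A -> R) (h : 'I_n.+1) (s : S) (a : A) :
  (forall k t, is_dist (pi k t)) ->
  occupancy M pi h s a = marginal (initial_law M pi) (kernel_law M pi) h (s, a).
Proof.
move=> pi1; rewrite -(@sum_path_weight _ _ _ _ n) ?inord_val -1?ltnS //.
  by apply: eq_bigr => tr _; exact: traj_probE.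
move=> k x; apply: (sum_dist_mul (trans M (inord k) x.1 x.2)) => //.
exact: trans_dist.
Qed.

(** * Occupancy measures *)

Lemma occupancy_start {R : realType} {S A : finType} {H : nat} (M : mdp R S A H)
    (pi : 'I_H -> S -> A -> R) (h : 'I_H) (s : S) (a : A) :
  (forall k t, is_dist (pi k t)) -> h = 0%N :> nat ->
  occupancy M pi h s a = init M s * pi h s a.
Proof.
case: H M pi h => [|n] M pi h; first by case: h.
move=> pi1 h0; rewrite occupancy_marginal // h0 /= /initial_law /=.
by congr (_ * pi _ _ _); apply/val_inj.
Qed.

Lemma occupancy_step {R : realType} {S A : finType} {H : nat} (M : mdp R S A H)
    (pi : 'I_H -> S -> A -> R) (h k : 'I_H) (s : S) (a : A) :
  (forall l t, is_dist (pi l t)) -> k = h.+1 :> nat ->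
  occupancy M pi k s a =
  (\sum_x occupancy M pi h x.1 x.2 * trans M h x.1 x.2 s) * pi k s a.
Proof.
case: H M pi h k => [|n] M pi h k; first by case: h.
move=> pi1 kh; rewrite occupancy_marginal // kh /= mulr_suml.
apply: eq_bigr => -[t b] _; rewrite occupancy_marginal // /kernel_law -kh.
by rewrite !inord_val /= mulrA.
Qed.

Lemma occupancy_ge0 {R : realType} {S A : finType} {H : nat} (M : mdp R S A H)
    (pi : 'I_H -> S -> A -> R) (h : 'I_H) (s : S) (a : A) :
  (forall k t, is_dist (pi k t)) -> 0 <= occupancy M pi h s a.
Proof.
move=> pi1; apply: sumr_ge0 => tr _; rewrite /traj_prob !mulr_ge0 //.
- by apply: prodr_ge0 => k _; exact: (init_dist M).1.
- by apply: prodr_ge0 => k _; exact: (pi1 _ _).1.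
- by do 2![apply: prodr_ge0 => ? _]; exact: (trans_dist M _ _ _).1.
Qed.

Lemma ord_pred_exists {n : nat} (k : 'I_n) :
  k = 0%N :> nat \/ exists h : 'I_n, k = h.+1 :> nat.
Proof.
case: k => -[|m] km; [by left | right].
by exists (Ordinal (ltnW km)).
Qed.

Lemma occupancy_dist {R : realType} {S A : finType} {H : nat} (M : mdp R S A H)
    (pi : 'I_H -> S -> A -> R) (h : 'I_H) :
  (forall k t, is_dist (pi k t)) ->
  is_dist (fun x : S * A => occupancy M pi h x.1 x.2).
Proof.
move=> pi1; split=> [x|]; first exact: occupancy_ge0.
have [m] := ubnP (h : nat); elim: m h => // m IHm h hm.
have [h0|[k hk]] := ord_pred_exists h.
  under eq_bigr => x _ do rewrite occupancy_start //.
  exact: sum_dist_mul (init_dist M) (pi1 h).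
under eq_bigr => x _ do rewrite (@occupancy_step _ _ _ _ M pi k) //.
apply: (sum_dist_mul (fun s => \sum_x occupancy M pi k x.1 x.2 * trans M k x.1 x.2 s)) => //.
split=> [s|].
  by apply: sumr_ge0 => x _; rewrite mulr_ge0 ?occupancy_ge0 //; exact: (trans_dist M _ _ _).1.
rewrite exchange_big /= -(IHm k); last by rewrite -ltnS -hk.
by apply: eq_bigr => x _; rewrite -mulr_sumr (trans_dist M _ _ _).2 mulr1.
Qed.

(** * Minimizers of the loss under Reset Cliff *)

(** Pointwise, [|p - q| = p + q - 2 min(p, q)], and both total masses are 1. *)
Lemma sum_norm_sub_dist {R : realType} {T : finType} (p q : T -> R) :
  is_dist p -> is_dist q ->
  \sum_x `|p x - q x| = 2 - 2 * \sum_x Num.min (p x) (q x).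
Proof.
move=> [_ p1] [_ q1].
transitivity (\sum_x (p x + q x - 2 * Num.min (p x) (q x))).
  by apply: eq_bigr => x _; rewrite minr_absE; lra.
by rewrite sumrB big_split /= p1 q1 mulr_sumr; congr (_ - _); lra.
Qed.

Lemma ail_lossE {R : realType} {S A : finType} {H : nat} (M : mdp R S A H)
    (target : 'I_H -> S -> A -> R) (pi : policy R S A H) :
  (forall h, is_dist (fun x : S * A => target h x.1 x.2)) ->
  ail_loss M target pi =
  \sum_h (2 - 2 * \sum_x Num.min (occupancy M pi h x.1 x.2) (target h x.1 x.2)).
Proof.
move=> target1; apply: eq_bigr => h _; apply: (@sum_norm_sub_dist _ (S * A)%type) => //.
exact/occupancy_dist/policy_dist.
Qed.

(** The overlap gaps [D] are nonnegative, while minimality of [pi] makes their total nonpositive; so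
    each of them vanishes. *)
Lemma ail_minimizer_min_eq {R : realType} {S A : finType} {H : nat} (M : mdp R S A H)
    (target : 'I_H -> S -> A -> R) (pi pi' : policy R S A H) :
  (forall h, is_dist (fun x : S * A => target h x.1 x.2)) ->
  ail_minimizer M target pi ->
  (forall h s a, Num.min (occupancy M pi h s a) (target h s a) <=
                 Num.min (occupancy M pi' h s a) (target h s a)) ->
  forall h s a, Num.min (occupancy M pi h s a) (target h s a) =
                Num.min (occupancy M pi' h s a) (target h s a).
Proof.
move=> target1 /(_ pi') min_pi le_min h s a.
pose D k (x : S * A) := Num.min (occupancy M pi' k x.1 x.2) (target k x.1 x.2) -
                        Num.min (occupancy M pi k x.1 x.2) (target k x.1 x.2).
have D0 k x : 0 <= D k x by rewrite subr_ge0.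
have DS0 k : 0 <= \sum_x D k x by apply: sumr_ge0.
have sumD : \sum_k \sum_x D k x = 0.
  apply/le_anti; rewrite sumr_ge0 // andbT -(pmulr_rle0 _ (ltr0n R 2)) mulr_sumr.
  rewrite -subr_le0 !ail_lossE // in min_pi; apply: le_trans min_pi.
  by rewrite -sumrB; apply: ler_sum => k _; rewrite /D sumrB; lra.
have /psumr_eq0P DE : \sum_x D h x = 0 by apply: (psumr_eq0P _ sumD).
by apply/esym/eqP; rewrite -subr_eq0; apply/eqP; exact: (DE _ (s, a)).
Qed.

Lemma occupancy_eq0 {R : realType} {S A : finType} {H : nat} (M : mdp R S A H)
    (pi : 'I_H -> S -> A -> R) (h : 'I_H) (s : S) (a : A) :
  pi h s a = 0 -> occupancy M pi h s a = 0.
Proof.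
move=> pi0; apply: big1 => tr /eqP trh.
by rewrite /traj_prob [X in _ * X * _](bigD1 h) //= trh pi0 mul0r mulr0 mul0r.
Qed.

Lemma deterministic_dist {R : realType} {S A : finType} {H : nat}
    (f : 'I_H -> S -> A) (h : 'I_H) (s : S) : is_dist (deterministic R f h s).
Proof.
split=> [a|]; first by rewrite /deterministic ler0n.
rewrite (bigD1 (f h s)) //= /deterministic eqxx big1 ?addr0 // => a /negPf->.
by [].
Qed.

Definition det_policy (R : realType) {S A : finType} {H : nat}
    (f : 'I_H -> S -> A) : policy R S A H := Policy (@deterministic_dist R _ _ _ f).

Lemma is_dist_le1 {R : realType} {T : finType} (p : T -> R) (x : T) :
  is_dist p -> p x <= 1.
Proof. by move=> [p0 <-]; rewrite (bigD1 x) //= lerDl sumr_ge0. Qed.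

(** * Propagation of mass among good states *)

Lemma reset_cliff_bad {R : realType} {S A : finType} {H : nat} {M : mdp R S A H}
    {piE : 'I_H -> S -> A} {a1 : A} {G B : {set S}} (s : S) :
  reset_cliff M piE a1 G B -> s \notin G -> s \in B.
Proof.
move=> rc sG; have : s \in G :|: B by rewrite (rc_cover rc) inE.
by rewrite inE (negPf sG).
Qed.

Lemma expert_occupancy_eq0 {R : realType} {S A : finType} {H : nat} {M : mdp R S A H}
    {piE : 'I_H -> S -> A} {a1 : A} {G B : {set S}} (h : 'I_H) (s : S) (a : A) :
  reset_cliff M piE a1 G B -> ~~ ((s \in G) && (a == a1)) ->
  occupancy M (deterministic R piE) h s a = 0.
Proof.
move=> rc; have [sG /= aa1|sG _] := boolP (s \in G).
  by apply: occupancy_eq0; rewrite /deterministic (rc_expert rc) // (negPf aa1).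
exact/(rc_expert_avoids_bad rc)/(reset_cliff_bad _ rc).
Qed.

(* Bad states have expert occupancy 0 at the first step as well, so init is
   carried by G. *)
Lemma reset_cliff_init {R : realType} {S A : finType} {H : nat} {M : mdp R S A H}
    {piE : 'I_H -> S -> A} {a1 : A} {G B : {set S}} :
  reset_cliff M piE a1 G B -> (0 < H)%N -> \sum_(s in G) init M s = 1.
Proof.
move=> rc H0; pose h := Ordinal H0; rewrite -(init_dist M).2 [RHS](bigID (mem G)) /=.
rewrite [X in _ = _ + X]big1 ?addr0 // => s sG.
have piE1 k t := @deterministic_dist R _ _ _ piE k t.
rewrite -[LHS]mulr1 -(piE1 h s).2 mulr_sumr big1 // => a _.
rewrite -occupancy_start //; apply: (rc_expert_avoids_bad rc).
exact: reset_cliff_bad rc sG.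
Qed.

(** Bad states and actions other than [a1] never lead to a good state, so only the pairs [(t, a1)]
    with [t] good feed [s]. *)
Lemma occupancy_step_good {R : realType} {S A : finType} {H : nat} {M : mdp R S A H}
    {piE : 'I_H -> S -> A} {a1 : A} {G B : {set S}} (pi : policy R S A H)
    {h k : 'I_H} {s : S} (a : A) :
  reset_cliff M piE a1 G B -> k = h.+1 :> nat -> s \in G ->
  occupancy M pi k s a =
  (\sum_(t in G) occupancy M pi h t a1 * trans M h t a1 s) * pi k s a.
Proof.
move=> rc kh sG; rewrite (@occupancy_step _ _ _ _ M pi h) //; last exact: policy_dist.
congr (_ * _).
rewrite -(pair_big xpredT xpredT (fun t b => occupancy M pi h t b * trans M h t b s)) /=.
rewrite (bigID (mem G)) /= [X in _ + X]big1 ?addr0 => [|t tG].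
  apply: eq_bigr => t tG; rewrite (bigD1 a1) //= big1 ?addr0 // => b ba1.
  by rewrite (rc_trans_cliff rc) ?mulr0.
by apply: big1 => b _; rewrite (rc_trans_bad rc) ?mulr0 ?(reset_cliff_bad _ rc).
Qed.

(** The mass on good pairs [(t, a1)] moves entirely to good states, where the policy keeps at most
    all of it on [a1]. *)
Lemma good_occupancy_nonincreasing {R : realType} {S A : finType} {H : nat}
    {M : mdp R S A H} {piE : 'I_H -> S -> A} {a1 : A} {G B : {set S}}
    (pi : policy R S A H) {h k : 'I_H} :
  reset_cliff M piE a1 G B -> k = h.+1 :> nat ->
  \sum_(s in G) occupancy M pi k s a1 <= \sum_(s in G) occupancy M pi h s a1.
Proof.
move=> rc kh.
have -> : \sum_(s in G) occupancy M pi h s a1 =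
    \sum_(s in G) \sum_(t in G) occupancy M pi h t a1 * trans M h t a1 s.
  rewrite exchange_big; apply: eq_bigr => t tG /=.
  by rewrite -mulr_sumr (rc_trans_good rc) ?mulr1.
apply: ler_sum => s sG; rewrite (occupancy_step_good pi _ rc kh sG).
apply: ler_piMr; last exact/is_dist_le1/policy_dist.
apply: sumr_ge0 => t _; rewrite mulr_ge0 ?occupancy_ge0 //; first exact: policy_dist.
exact: (trans_dist M _ _ _).1.
Qed.

Lemma good_occupancy_always {R : realType} {S A : finType} {H : nat}
    {M : mdp R S A H} {piE : 'I_H -> S -> A} {a1 : A} {G B : {set S}} (h : 'I_H) :
  reset_cliff M piE a1 G B ->
  \sum_(s in G) occupancy M (det_policy R (fun _ _ => a1)) h s a1 = 1.
Proof.
move=> rc; have [m] := ubnP (h : nat); elim: m h => // m IHm h hm.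
have [h0|[k hk]] := ord_pred_exists h.
  rewrite -(reset_cliff_init rc (leq_ltn_trans (leq0n h) (ltn_ord h))).
  apply: eq_bigr => s _; rewrite occupancy_start // ?/= /deterministic ?eqxx ?mulr1 //.
  exact: deterministic_dist.
rewrite -(IHm k); last by rewrite -ltnS -hk.
under eq_bigr => s sG do
  rewrite (occupancy_step_good _ _ rc hk sG) /= /deterministic eqxx mulr1.
rewrite exchange_big; apply: eq_bigr => t tG /=.
by rewrite -mulr_sumr (rc_trans_good rc) ?mulr1.
Qed.

Lemma good_occupancy_le_always {R : realType} {S A : finType} {H : nat}
    {M : mdp R S A H} {piE : 'I_H -> S -> A} {a1 : A} {G B : {set S}}
    (pi : policy R S A H) (h : 'I_H) (s : S) :
  reset_cliff M piE a1 G B -> s \in G ->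
  occupancy M pi h s a1 <= occupancy M (det_policy R (fun _ _ => a1)) h s a1.
Proof.
move=> rc; have [m] := ubnP (h : nat); elim: m h s => // m IHm h s hm sG.
have pi_le1 : pi h s a1 <= 1 by apply/is_dist_le1/policy_dist.
have [h0|[k hk]] := ord_pred_exists h.
  rewrite !occupancy_start //; [|exact: deterministic_dist|exact: policy_dist].
  by apply: ler_wpM2l; [exact: (init_dist M).1|rewrite /= /deterministic eqxx].
rewrite !(occupancy_step_good _ _ rc hk sG); apply: ler_pM.
- apply: sumr_ge0 => t _; rewrite mulr_ge0 ?occupancy_ge0 //; first exact: policy_dist.
  exact: (trans_dist M _ _ _).1.
- exact: (policy_dist _ _ _).1.
- apply: ler_sum => t tG; rewrite ler_wpM2r ?IHm //; last by rewrite -ltnS -hk.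
  exact: (trans_dist M _ _ _).1.
- by rewrite /= /deterministic eqxx.
Qed.

(** Some good state has an occupancy deficit at step [h], and positive transitions pass it on to
    every good state at the next step. *)
Lemma good_occupancy_lt_always {R : realType} {S A : finType} {H : nat}
    {M : mdp R S A H} {piE : 'I_H -> S -> A} {a1 : A} {G B : {set S}}
    (pi : policy R S A H) {h k : 'I_H} {s : S} :
  reset_cliff M piE a1 G B -> k = h.+1 :> nat -> s \in G ->
  \sum_(t in G) occupancy M pi h t a1 < 1 ->
  occupancy M pi k s a1 < occupancy M (det_policy R (fun _ _ => a1)) k s a1.
Proof.
move=> rc kh sG; rewrite -(good_occupancy_always h rc) => lt_sum.
rewrite !(occupancy_step_good _ _ rc kh sG) /= {2}/deterministic eqxx mulr1.
set occ' := occupancy M (deterministic R (fun=> fun=> a1)).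
have le_occ t : t \in G -> occupancy M pi h t a1 <= occ' h t a1.
  exact: (good_occupancy_le_always pi h t rc).
have tr_ge0 t : 0 <= trans M h t a1 s by exact: (trans_dist M _ _ _).1.
apply: (@le_lt_trans _ _ (\sum_(t in G) occupancy M pi h t a1 * trans M h t a1 s)).
  apply: ler_piMr; last exact/is_dist_le1/policy_dist.
  by apply: sumr_ge0 => t _; rewrite mulr_ge0 ?occupancy_ge0 //; exact: policy_dist.
rewrite lt_def; apply/andP; split; last first.
  by apply: ler_sum => t tG; rewrite ler_wpM2r ?le_occ.
(* Equal inflows into [s] would make every weighted deficit zero, hence every deficit, leaving no
   loss of good mass at step [h]. *)
apply: contraTneq lt_sum => eq_sum; rewrite -leNgt; apply: ler_sum => t tG.
have diff_ge0 u : u \in G ->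
    0 <= (occ' h u a1 - occupancy M pi h u a1) * trans M h u a1 s.
  by move=> uG; rewrite mulr_ge0 // subr_ge0 le_occ.
have diff0 : \sum_(u in G)
    (occ' h u a1 - occupancy M pi h u a1) * trans M h u a1 s = 0.
  by under eq_bigr => u _ do rewrite mulrBl; rewrite sumrB eq_sum subrr.
have /eqP := psumr_eq0P diff_ge0 diff0 tG.
by rewrite mulf_eq0 (gt_eqF (rc_trans_pos rc h tG sG)) orbF subr_eq0 => /eqP <-.
Qed.

(* If a policy has lost good mass at step h, then at the next step it is below
   the target at some good state, and always playing a1 gains strictly there. *)
Lemma minimizer_good_occupancy {R : realType} {S A : finType} {H : nat}
    {M : mdp R S A H} {piE : 'I_H -> S -> A} {a1 : A} {G B : {set S}}
    {target : 'I_H -> S -> A -> R} (pi : policy R S A H) (h k : 'I_H) :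
  reset_cliff M piE a1 G B ->
  (forall l, is_dist (fun x : S * A => target l x.1 x.2)) ->
  (forall l s a, ~~ ((s \in G) && (a == a1)) -> target l s a = 0) ->
  ail_minimizer M target pi -> k = h.+1 :> nat ->
  1 <= \sum_(s in G) occupancy M pi h s a1.
Proof.
move=> rc target1 target0 min_pi kh; rewrite leNgt; apply/negP => lt1.
pose pi' := det_policy R (fun (_ : 'I_H) (_ : S) => a1).
have min_eq := ail_minimizer_min_eq M target pi pi' target1 min_pi.
(* Otherwise the good mass at step [k] is at least that of the target, namely 1, and so is the good
   mass at step [h]. *)
have [s sG lt_s] : exists2 s, s \in G & occupancy M pi k s a1 < target k s a1.
  apply/exists_inP; apply: contraTT lt1 => /exists_inPn le_target; rewrite -leNgt.
  apply: le_trans (good_occupancy_nonincreasing pi rc kh).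
  rewrite -(target1 k).2 -(pair_big xpredT xpredT (target k)) /= (bigID (mem G)) /=.
  rewrite [X in _ + X]big1 ?addr0 => [|s sG].
    apply: ler_sum => s sG; rewrite (bigD1 a1) //= big1 ?addr0 => [|a aa1].
      by rewrite leNgt le_target.
    by rewrite target0 // (negPf aa1) andbF.
  by apply: big1 => a _; rewrite target0 // (negPf sG).
have lt_occ := good_occupancy_lt_always pi rc kh sG lt1.
have := min_eq _ k s a1; rewrite (min_idPl (ltW lt_s)) => eq_min.
(* At [s] the overlap of [pi] is its own occupancy, which both the target and the occupancy of [pi']
   exceed. This contradicts equality of overlaps, once [pi'] is seen to dominate: off the good pairs
   both overlaps are 0. *)
suff : occupancy M pi k s a1 < Num.min (occupancy M pi' k s a1) (target k s a1).
  rewrite -eq_min ?ltxx // => l t a.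
  have [/andP[tG /eqP->]|off] := boolP ((t \in G) && (a == a1)).
    by rewrite le_min !ge_min lexx orbT andbT (good_occupancy_le_always pi l t rc tG).
  by rewrite target0 // !(min_idPr _) ?occupancy_ge0 //; exact: policy_dist.
by rewrite lt_min lt_occ.
Qed.

(** Full mass on the good pairs leaves none for [(s, a)] with [a != a1]. Since [s] is reached with
    positive probability, the policy itself must give such actions probability 0. *)
Lemma ail_minimizer_expert {R : realType} {S A : finType} {H : nat}
    {M : mdp R S A H} {piE : 'I_H -> S -> A} {a1 : A} {G B : {set S}}
    {target : 'I_H -> S -> A -> R} (pi : policy R S A H) (h : 'I_H) (s : S) :
  reset_cliff M piE a1 G B ->
  (forall l, is_dist (fun x : S * A => target l x.1 x.2)) ->
  (forall l s a, ~~ ((s \in G) && (a == a1)) -> target l s a = 0) ->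
  ail_minimizer M target pi ->
  (h.+1 < H)%N -> s \in G -> (h = 0%N :> nat -> 0 < init M s) ->
  pi h s a1 = 1.
Proof.
move=> rc target1 target0 min_pi hH sG init_gt0.
have pi1 := policy_dist pi.
have good1 : 1 <= \sum_(t in G) occupancy M pi h t a1.
  exact: (minimizer_good_occupancy pi h (Ordinal hH) rc).
have tot := (occupancy_dist M pi h pi1).2.
have occ_other a : a != a1 -> occupancy M pi h s a = 0.
  move=> aa1; apply/le_anti; rewrite occupancy_ge0 // andbT.
  have occ0 t b := occupancy_ge0 M pi h t b pi1.
  (* The good mass, at least 1, and the occupancy of [(s, a)] are disjoint parts of a total mass
     1. *)
  rewrite -(lerD2l 1) addr0 -{2}tot; apply: le_trans (lerD good1 (lexx _)) _.
  rewrite -(pair_big xpredT xpredT (occupancy M pi h)) /= [leRHS](bigID (mem G)) /=.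
  rewrite ler_wpDr ?sumr_ge0 // => [t _|]; first exact: sumr_ge0.
  rewrite (bigD1 s) //= [leRHS](bigD1 s) //= addrAC lerD //.
    by rewrite (bigD1 a1) //= lerD2l (bigD1 a) //= lerDl sumr_ge0.
  by apply: ler_sum => t _; rewrite (bigD1 a1) //= lerDl sumr_ge0.
(* The constant [c] is the probability of being in [s] at step [h]. After the first step it is
   positive because the good mass one step earlier is at least 1 and all transitions between good
   states by [a1] are positive. *)
have [c c_gt0 occE] : exists2 c, 0 < c & forall a, occupancy M pi h s a = c * pi h s a.
  have [h0|[k hk]] := ord_pred_exists h.
    by exists (init M s) => [|a]; [exact: init_gt0 | exact: occupancy_start].
  exists (\sum_(t in G) occupancy M pi k t a1 * trans M k t a1 s) => [|a]; last first.
    exact: occupancy_step_good rc hk sG.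
  have := minimizer_good_occupancy pi k h rc target1 target0 min_pi hk.
  apply: contraTT; rewrite -leNgt -ltNge => le0.
  rewrite big1 ?ltr01 // => t tG.
  have term_ge0 u : u \in G -> 0 <= occupancy M pi k u a1 * trans M k u a1 s.
    by move=> uG; rewrite mulr_ge0 ?occupancy_ge0 // ltW // (rc_trans_pos rc).
  have sum0 : \sum_(u in G) occupancy M pi k u a1 * trans M k u a1 s = 0.
    by apply/le_anti; rewrite le0 sumr_ge0.
  have /eqP := psumr_eq0P term_ge0 sum0 tG.
  by rewrite mulf_eq0 (gt_eqF (rc_trans_pos rc k tG sG)) orbF => /eqP.
rewrite -[RHS](pi1 h s).2 (bigD1 a1) //= big1 ?addr0 // => a /occ_other/eqP.
by rewrite occE mulf_eq0 (gt_eqF c_gt0) => /eqP.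
Qed.

(** * Almost sure support of the estimate *)

(** Any preimage is a finite union of the events [X = t]. *)
Lemma measurable_fun_finite_factor {R : realType} {d : measure_display}
    {Omega : measurableType d} {T : finType} (X : Omega -> T) (f : T -> R) :
  (forall t, measurable [set w | X w = t]%classic) ->
  measurable_fun setT (f \o X).
Proof.
move=> mX _ Y _; rewrite setTI.
have -> : ((f \o X) @^-1` Y = \bigcup_(t in [set t | Y (f t)]) [set w | X w = t])%classic.
  by apply/seteqP; split => [w Yw|w [t Yt /= Xt]] /=; [exists (X w) | rewrite Xt].
by apply: fin_bigcup_measurable => //; exact: finite_finset.
Qed.

Lemma ae_eq0_of_expectation {R : realType} {d : measure_display}
    {Omega : measurableType d} (Pr : probability Omega R) (X : Omega -> R) :
  measurable_fun setT X -> (forall w, 0 <= X w) -> ('E_Pr[X] = 0)%E ->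
  {ae Pr, forall w, X w = 0}.
Proof.
move=> mX X0 EX.
have mEX : measurable_fun setT (EFin \o X) by exact/measurable_EFinP.
have /(ae_eq_integral_abs Pr measurableT mEX)[N [mN N0 NX]] :
    (\int[Pr]_w `|(EFin \o X) w| = 0)%E.
  move: EX; rewrite unlock => <-; apply: eq_integral => w _ /=.
  by rewrite ger0_norm.
exists N; split => // w /= nX; apply: NX => /= XE; apply: nX.
by have [] := XE I.
Qed.

(** With steps counted from 0, [h.+1 < H] ranges over all steps but the last. At the first step the
    claim concerns the good states charged by [init]: at any other state the first action changes no
    occupancy, so the loss cannot determine it. *)
Theorem proposition3 (R : realType) (S A : finType) (H : nat)
    (M : mdp R S A H) (piE : 'I_H -> S -> A) (a1 : A) (G B : {set S})
    (d : measure_display) (Omega : measurableType d) (Pr : probability Omega R)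
    (n : nat) (D : Omega -> n.-tuple (trajectory S A H))
    (Phat : estimator R S A H n) :
  reset_cliff M piE a1 G B ->
  iid_dataset Pr M (deterministic R piE) D ->
  distribution_valued Phat ->
  unbiased Pr M (deterministic R piE) D Phat ->
  (1 <= n)%N ->
  {ae Pr, forall w, forall piAIL : policy R S A H,
    ail_minimizer M (Phat (D w)) piAIL ->
    forall (h : 'I_H) (s : S), (h.+1 < H)%N -> s \in G ->
      (h = 0%N :> nat -> 0 < init M s) ->
      piAIL h s a1 = 1}.
Proof.
move=> rc iidD Phat1 unbPhat _.
have Phat_off (x : 'I_H * S * A) :
    {ae Pr, forall w, ~~ ((x.1.2 \in G) && (x.2 == a1)) ->
      Phat (D w) x.1.1 x.1.2 x.2 = 0}.
  case: x => -[h s] a /=.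
  have [_|off] := boolP ((s \in G) && (a == a1)); first by apply: filterE.
  have /= := @ae_eq0_of_expectation _ _ _ Pr (fun w => Phat (D w) h s a).
  move=> ae0; apply: filterS (ae0 _ _ _) => [w ? //| |w|].
  - apply: (measurable_fun_finite_factor D (fun ds => Phat ds h s a)) => ds.
    by have [] := iidD ds.
  - exact: ((Phat1 (D w) h).1 (s, a)).
  - by rewrite unbPhat (expert_occupancy_eq0 h s a rc off).
(* The triples [(h, s, a)] are finitely many, so one null set serves them all; it is fixed before
   the minimizer is chosen. *)
apply: filterS (filter_forall _ Phat_off) => w off pi min_pi h s.
apply: (ail_minimizer_expert pi h s rc (Phat1 (D w)) _ min_pi) => l t a.
exact: (off (l, t, a)).
Qed.
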